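(* Let $r=r(n)\ge 2$ be integers with $r=o\left(\sqrt{\frac{n}{\ln n}}\right)$ as $n\to\infty$. Then there is an explicit construction of an $n$-uniform hypergraph $H=(V,E)$ (one for each $n$) that has no panchromatic $r$-coloring and satisfies $$|E(H)|=\left(\frac{r}{r-1}+o(1)\right)^n\qquad (n\to\infty).$$
   Context: A hypergraph is a pair $(V,E)$ where $V$ is a finite set (of vertices) and $E$ is a family of subsets of $V$ (edges). It is $n$-uniform if every edge has size $n$. A vertex $r$-coloring is a map $V\to\{1,\dots,r\}$; it is called panchromatic if every edge contains a vertex of every one of the $r$ colors. ''Explicit'' is used in the usual informal sense: the hypergraph is given by a direct deterministic description, not by a probabilistic existence argument. *)

(* Defs.v *)
From mathcomp Require Import all_boot.

Set Implicit Arguments.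
Unset Strict Implicit.
Unset Printing Implicit Defensive.

Record hypergraph := Hypergraph {
  vertex : finType;
  edges : {set {set vertex}}
}.

Definition uniform (n : nat) (H : hypergraph) : Prop :=
  forall e, e \in edges H -> #|e| = n.

Definition panchromatic (H : hypergraph) (r : nat) (f : vertex H -> 'I_r) : Prop :=
  forall e, e \in edges H -> forall c : 'I_r, exists2 v, v \in e & f v = c.

(* An explicit n-uniform hypergraph without panchromatic r-coloring (r >= 2).
   Below s = box_width, k = box_height, m = copy_size, b = copies_per_color.
   The vertices form r * b disjoint copies of an m-element set.  The edges are
   the n-subsets of the boxes K x T, where K consists of k copies and T is a
   set of s positions, the same in every copy of K; note that n <= k * s.

   In each copy some color occurs at most m %/ r times, and some color c plays
   this role in at least b copies.  In each of these, at least
   'C(m - m %/ r, s) of the 'C(m, s) position sets T avoid c.  The choice of b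
   makes b * 'C(m - m %/ r, s) > k * 'C(m, s), so one T avoids c in k copies,
   which gives edges missing the color c.
   With s about sqrt n and m = s ^ 2, the product 'C(m, s) * 'C(r * b, k) is
   (r / (r - 1)) ^ n up to a factor exp(o(n)), and each box contains only
   exp(o(n)) edges, since k * s - n <= s. *)
Section BoxHypergraph.
Variables n r : nat.

Definition box_width : nat := (Nat.sqrt n).+1.
Definition box_height : nat := (n %/ box_width).+1.
Definition copy_size : nat := box_width ^ 2.
Definition copies_per_color : nat :=
  (box_height * 'C(copy_size, box_width)
     %/ 'C(copy_size - copy_size %/ r, box_width)).+1.

Definition box_vertex : finType :=
  ('I_(r * copies_per_color) * 'I_copy_size)%type.

Definition box_hypergraph : hypergraph :=
  @Hypergraph box_vertex
    [set e : {set box_vertex} | (#|e| == n) &&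
       [exists K : {set 'I_(r * copies_per_color)},
        exists T : {set 'I_copy_size},
          [&& #|K| == box_height, #|T| == box_width & e \subset setX K T]]].

End BoxHypergraph.

(* Main.v *)
Require Import Defs.
From mathcomp Require Import all_boot all_order all_algebra.
From mathcomp Require Import all_classical all_reals all_analysis.
From mathcomp Require Import zify ring lra.
From Stdlib Require PeanoNat.
Import Order.TTheory GRing.Theory Num.Theory numFieldNormedType.Exports.

Set Implicit Arguments.
Unset Strict Implicit.
Unset Printing Implicit Defensive.

(** Write x = r / (r - 1), s = box_width n (about sqrt n), k = box_height n,
    m = s ^ 2, and b = copies_per_color n r.

    Why no coloring is panchromatic: in each of the r * b copies some color
    occurs at most m / r times, so some color c is rare in at least b copies
    (popular_color).  Averaging over the position sets T of size s, the choice
    of b gives a T that avoids c in more than k of these copies, and any n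
    vertices of the resulting box form an edge without c
    (box_not_panchromatic).

    Why there are not more edges than claimed: an edge is determined by k
    copies, s positions and an n-subset of a box of k * s <= n + s vertices.
    The last two choices, and the factors r and k + 1 in r * b, contribute
    s ^ O(s) = exp(o(n)) when r <= s, which holds for large n because
    r = o(sqrt (n / ln n)).  What remains is the k-th power of
    'C(m, s) / 'C(m - m %/ r, s); comparing falling factorials factor by factor
    bounds this quotient by (x * (s - 1) / (s - 2)) ^ s (falling_factor_le), and
    ((s - 1) / (s - 2)) ^ (s * s) is again exp(o(n)).  So the number of edges is
    at most x ^ n * s ^ (9 * s) (card_box_edges_le_ratio).

    Why there are not fewer: this is true of every n-uniform hypergraph without
    a panchromatic r-coloring.  A uniformly random coloring misses a given color
    on a given edge with probability (1 - 1 / r) ^ n, so by the union bound at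
    least x ^ n / r edges are needed (card_edges_ge).

    Both bounds have the form x ^ n * exp(o(n)), and since 1 <= x <= 2, taking
    n-th roots gives x + o(1) (nth_root_sub_cvg0). *)

(** * Finite counting *)

Lemma exists_subset_card (T : finType) (A : {set T}) k :
  k <= #|A| -> exists2 B : {set T}, B \subset A & #|B| = k.
Proof.
rewrite -bin_gt0 -cards_draws => /card_gt0P[B].
by rewrite inE => /andP[BA /eqP cB]; exists B.
Qed.

Lemma exists_gt_average (I : finType) (A : {set I}) (F : I -> nat) a :
  a * #|A| < \sum_(i in A) F i -> exists2 i, i \in A & a < F i.
Proof.
move=> lt_a; apply/exists_inP; apply: contraLR lt_a => /exists_inPn small.
rewrite -leqNgt mulnC -sum_nat_const.
by apply: leq_sum => i /small; rewrite -leqNgt.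
Qed.

Lemma card_sum_fibers (T I : finType) (A : {set T}) (f : T -> I) :
  #|A| = \sum_(c : I) #|[set x in A | f x == c]|.
Proof.
rewrite -sum1_card (partition_big f xpredT) //=.
by apply: eq_bigr => c _; rewrite -sum1_card; apply: eq_bigl => x; rewrite inE.
Qed.

Lemma popular_color (T : finType) (r b : nat) (f : T -> 'I_r) :
  0 < r -> 0 < b -> r * b <= #|T| -> exists c, b <= #|[set x | f x == c]|.
Proof.
move=> r0 b0 hT; have [|c _ hc] := @exists_gt_average _ [set: 'I_r]
  (fun c => #|[set x in [set: T] | f x == c]|) b.-1.
  under eq_bigl do rewrite inE.
  rewrite -card_sum_fibers !cardsT card_ord; nia.
exists c; move: hc; rewrite prednK // => /leq_trans; apply.
by apply: subset_leq_card; apply/fintype.subsetP => x; rewrite !inE.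
Qed.

(** Pigeonhole for small classes: if every color occurred more than #|T| / r
    times, the classes would not fit in T. *)
Lemma rare_color (T : finType) (r : nat) (f : T -> 'I_r) :
  0 < r -> exists c, #|[set x | f x == c]| <= #|T| %/ r.
Proof.
move=> r0; apply/existsP; apply: contraT => /existsPn big.
have : \sum_(c < r) (#|T| %/ r).+1 <= #|[set: T]|.
  rewrite (card_sum_fibers _ f); apply: leq_sum => c _.
  have := big c; rewrite -ltnNge => /leq_trans; apply.
  by apply: subset_leq_card; apply/fintype.subsetP => x; rewrite !inE.
by rewrite sum_nat_const card_ord cardsT mulnC leqNgt ltn_ceil.
Qed.

(** * Uniform hypergraphs without panchromatic colorings have many edges *)

(** Colorings form a product, with r - 1 allowed values at a vertex of e and r at
    any other vertex. *)
Lemma card_colorings_avoiding (V : finType) (r : nat) (e : {set V}) (c : 'I_r) :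
  #|[set f : {ffun V -> 'I_r} | [forall v in e, f v != c]]|
    = r.-1 ^ #|e| * r ^ (#|V| - #|e|).
Proof.
pose F v : pred 'I_r := if v \in e then [pred d | d != c] else predT.
have -> : #|[set f : {ffun V -> 'I_r} | [forall v in e, f v != c]]| = #|family F|.
  apply: eq_card => f; rewrite inE; apply/forall_inP/familyP => h v; last first.
    by move=> ve; have := h v; rewrite /F ve.
  by rewrite /F; case: ifP => // ve; apply: h.
rewrite card_family foldrE big_map big_enum /=.
rewrite -[in #|V|](cardsC e) addKn -!prod_nat_const (bigID (mem e)) /=; congr (_ * _)%N.
  apply: eq_bigr => v ve; rewrite /F ve.
  by have := cardC1 c; rewrite card_ord => <-; apply: eq_card => d; rewrite !inE.
apply: eq_big => [v|v /negPf ve]; first by rewrite !inE.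
by rewrite /F ve card_ord.
Qed.

Lemma leq_card_bigcup (I T : finType) (A : {set I}) (F : I -> {set T}) a :
  (forall i, i \in A -> #|F i| <= a) -> #|\bigcup_(i in A) F i| <= #|A| * a.
Proof.
move=> le_a; rewrite -sum_nat_const.
elim/big_ind2: _ => [|m U p W hU hW|i /le_a //]; first by rewrite cards0.
by rewrite (leq_trans (leq_card_setU U W)) ?leq_add.
Qed.

(** Union bound: every coloring misses some color on some edge, and each of the
    #|edges H| * r pairs (edge, color) accounts for a proportion
    ((r - 1) / r) ^ n of all colorings. *)
Lemma card_edges_ge (n r : nat) (H : hypergraph) : 0 < r -> uniform n H ->
  ~ (exists f : vertex H -> 'I_r, panchromatic f) ->
  r ^ n <= #|edges H| * (r * r.-1 ^ n).
Proof.
move=> r0 unif nopan.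
have cover : [set: {ffun vertex H -> 'I_r}] \subset
    \bigcup_(e in edges H) \bigcup_(c in [set: 'I_r])
      [set f : {ffun vertex H -> 'I_r} | [forall v in e, f v != c]].
  apply/fintype.subsetP => f _; apply: contraT => /finset.bigcupP nf.
  case: nopan; exists f.
  move=> e eH c; have [/exists_inP[v ve /eqP fv]|/exists_inPn h] :=
    boolP [exists v in e, f v == c]; first by exists v.
  case: nf; exists e => //; apply/finset.bigcupP; exists c; rewrite inE //.
  by apply/forall_inP => v /h.
have /card_gt0P[e0 e0H] : 0 < #|edges H|.
  rewrite lt0n; apply/eqP => /cards0_eq E0; case: nopan.
  by exists (fun=> Ordinal r0) => e; rewrite E0 inE.
have nV : n <= #|vertex H| by rewrite -(unif _ e0H) max_card.
have := subset_leq_card cover; rewrite cardsT card_ffun card_ord => /leq_trans.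
move=> /(_ _ (leq_card_bigcup (a := r * (r.-1 ^ n * r ^ (#|vertex H| - n))) _)) le_V.
rewrite -(@leq_pmul2r (r ^ (#|vertex H| - n))) ?expn_gt0 ?r0 // -expnD subnKC //.
rewrite -!mulnA; apply: le_V => e eH.
rewrite -[X in _ <= X * _](card_ord r) -(cardsT 'I_r); apply: leq_card_bigcup => c _.
by rewrite card_colorings_avoiding (unif _ eH).
Qed.

(** * The box hypergraph has no panchromatic coloring *)

Lemma box_uniform n r : uniform n (box_hypergraph n r).
Proof. by move=> e; rewrite inE => /andP[/eqP]. Qed.

Lemma lt_box_width_sq n : n < box_width n ^ 2.
Proof.
have := PeanoNat.Nat.sqrt_spec n (PeanoNat.Nat.le_0_l n).
by rewrite -mulnn /box_width; lia.
Qed.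

Lemma box_height_le_width n : box_height n <= box_width n.
Proof. by rewrite /box_height ltn_divLR // mulnn lt_box_width_sq. Qed.

Lemma box_volume_gt n : n < box_height n * box_width n.
Proof. exact: ltn_ceil. Qed.

Lemma box_volume_le n : box_height n * box_width n <= n + box_width n.
Proof. by rewrite mulSn addnC leq_add2r leq_trunc_div. Qed.

(** The quotient defining copies_per_color has a positive divisor: a copy has at
    least half of its s ^ 2 positions outside a rare color, hence at least s of
    them once s >= 2, and for s = 1 the single position is outside. *)
Lemma binomial_ratio_gap n r : 1 < r ->
  box_height n * 'C(copy_size n, box_width n)
    < copies_per_color n r * 'C(copy_size n - copy_size n %/ r, box_width n).
Proof.
move=> r1; apply: ltn_ceil; rewrite bin_gt0.
have := leq_trunc_div (copy_size n) r.
rewrite /copy_size -mulnn /box_width; case: (Nat.sqrt n) => [|t]; last by nia.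
by rewrite divn_small.
Qed.

(** Double counting of the pairs (copy where c is rare, position set avoiding c
    in that copy) produces a position set avoiding c in more than k copies. *)
Lemma box_not_panchromatic n r : 1 < r ->
  ~ exists f : vertex (box_hypergraph n r) -> 'I_r, panchromatic f.
Proof.
move=> r1 [f pan]; have r0 := ltnW r1.
set s := box_width n; set k := box_height n.
set m := copy_size n; set b := copies_per_color n r.
have [g g_rare] := fin_all_exists (fun i : 'I_(r * b) =>
  rare_color (fun x : 'I_m => f (i, x)) r0).
have [|c] := popular_color (b := b) g r0 isT; first by rewrite card_ord.
set K0 := [set i | g i == c] => le_b.
pose avoiding i := [set x | f (i, x) != c].
pose G i := [set T : {set 'I_m} | T \subset avoiding i & #|T| == s].
have G_ge i : i \in K0 -> 'C(m - m %/ r, s) <= #|G i|.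
  rewrite inE => /eqP gi; rewrite cards_draws leq_bin2l //.
  rewrite leq_subLR; have := cardsC [set x | f (i, x) == c].
  have -> : ~: [set x | f (i, x) == c] = avoiding i by apply/finset.setP => x; rewrite !inE.
  rewrite card_ord -/m => {1}<-; rewrite leq_add2r -gi.
  by have := g_rare i; rewrite card_ord.
(* Counted copy by copy, the pairs number at least b * 'C(m - m %/ r, s), which
   exceeds k times the number of position sets. *)
have [T] : exists2 T, T \in [set T : {set 'I_m} | #|T| == s] &
    k < #|[set i in K0 | T \in G i]|.
  apply: exists_gt_average; rewrite card_draws card_ord.
  apply: leq_trans (binomial_ratio_gap n r1) _.
  under eq_bigr do rewrite -sum1_card.
  rewrite (exchange_big_dep (mem K0)) /= => [|T i _]; last by rewrite inE => /andP[].
  apply: leq_trans (leq_mul le_b (leqnn _)) _; rewrite -sum_nat_const.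
  apply: leq_sum => i iK; apply: leq_trans (G_ge i iK) _.
  rewrite -sum1_card; apply/eq_leq/eq_bigl => T.
  by move: iK; rewrite !inE => ->; case: (#|T| == s); rewrite ?andbF ?andbT.
rewrite inE => /eqP cT /ltnW kG; have [K /fintype.subsetP KG cK] := exists_subset_card kG.
have [e eKT ce] : exists2 e : {set box_vertex n r}, e \subset finset.setX K T & #|e| = n.
  by apply: exists_subset_card; rewrite cardsX cK cT ltnW ?box_volume_gt.
have eE : e \in edges (box_hypergraph n r).
  rewrite inE ce eqxx; apply/existsP; exists K; apply/existsP; exists T.
  by rewrite cK cT !eqxx.
have [[i x] ix_e fix_c] := pan e eE c.
have /finset.setXP[/KG] := fintype.subsetP eKT _ ix_e.
rewrite !inE => /and3P[_ /fintype.subsetP Tav _] /Tav.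
by rewrite inE fix_c eqxx.
Qed.

(** * Upper bound on the number of edges *)

Lemma card_box_edges n r :
  #|edges (box_hypergraph n r)| <=
    'C(r * copies_per_color n r, box_height n) *
    ('C(copy_size n, box_width n) * 'C(box_height n * box_width n, n)).
Proof.
set s := box_width n; set k := box_height n; set m := copy_size n.
set b := copies_per_color n r.
pose Ks := [set K : {set 'I_(r * b)} | #|K| == k].
pose Ts := [set T : {set 'I_m} | #|T| == s].
have cover : edges (box_hypergraph n r) \subset \bigcup_(K in Ks) \bigcup_(T in Ts)
    [set e : {set box_vertex n r} | e \subset finset.setX K T & #|e| == n].
  apply/fintype.subsetP => e; rewrite inE.
  move=> /andP[ce /existsP[K /existsP[T /and3P[cK cT eKT]]]].
  apply/finset.bigcupP; exists K; rewrite ?inE //.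
  apply/finset.bigcupP; exists T; rewrite ?inE //.
  by rewrite eKT.
apply: leq_trans (subset_leq_card cover) _.
rewrite -[X in 'C(X, k)]card_ord -(card_draws _ k).
apply: leq_card_bigcup => K; rewrite inE => /eqP cK.
rewrite -[X in 'C(X, s)]card_ord -(card_draws _ s).
apply: leq_card_bigcup => T; rewrite inE => /eqP cT.
by rewrite cards_draws cardsX cK cT.
Qed.

Lemma leq_bin_exp n k : 'C(n, k) <= n ^ k.
Proof.
apply: (@leq_trans (n ^_ k)); first by rewrite -bin_ffact leq_pmulr ?fact_gt0.
rewrite ffact_prod -[X in _ <= _ ^ X]card_ord -prod_nat_const.
by apply: leq_prod => i _; apply: leq_subr.
Qed.

(** Since q <= s ^ 2 / r, a factor s ^ 2 - j of the falling factorial of s ^ 2 is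
    about r / (r - 1) times the factor s ^ 2 - q - j; the correction
    (s - 1) / (s - 2) absorbs the influence of j < s. *)
Lemma falling_factor_le r s q j : 1 < r -> 1 < s -> q * r <= s * s ->
  q + s <= s * s -> j < s ->
  (s * s - j) * (r.-1 * (s - 2)) <= (s * s - q - j) * (r * s.-1).
Proof.
move=> r1 s1 rq sm js; have [N eN] : exists N, s * s = N + q + j.
  by exists (s * s - q - j); lia.
have -> : s * s - j = N + q by lia.
have -> : s * s - q - j = N by lia.
(* With N for the smaller factor and r = r' + 1, the claim reduces to
   j * (s - 2) <= N * r, which holds because N * r is at least
   s ^ 2 * (r - 1) - r * j. *)
case: r r1 rq => [//|r'] /= r1 rq; have qr : q * r' <= N + j by nia.
case: s s1 eN rq sm js => [//|[//|t]] _ eN rq sm js; rewrite subn2 /=.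
have h1 : q * r' * t <= (N + j) * t by rewrite leq_mul2r qr orbT.
have h2 : t.+2 * t.+2 * r' <= N * r'.+1 + j * r'.+1.
  have: (N + q + j) * r'.+1 <= N * r'.+1 + j * r'.+1 + (t.+2 * t.+2) by nia.
  rewrite -eN; lia.
have h3 : j * t.+2 <= t.+2 * t.+2 by rewrite leq_mul2r ltnW ?orbT.
have h4 : (t.+2 * t.+2 - j) * 1 <= (t.+2 * t.+2 - j) * r'.
  by rewrite leq_mul2l; apply/orP; right.
have h5 : j * t <= N * r'.+1 by nia.
lia.
Qed.

(** The bound b <= (k + 1) * (r / (r - 1) * ((s - 1) / (s - 2))) ^ s, cleared of
    denominators.  The extra 1 in k + 1 pays for rounding up in the definition of
    b, the quotient of binomials being at least 1. *)
Lemma copies_per_color_le n r : 1 < r -> 2 < box_width n ->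
  copies_per_color n r * (r.-1 * (box_width n - 2)) ^ box_width n
    <= (box_height n).+1 * (r * (box_width n).-1) ^ box_width n.
Proof.
move=> r1 s2; set s := box_width n; set k := box_height n.
set m := copy_size n; set q := m %/ r.
have sm : s <= m - q.
  have := leq_trunc_div m r; rewrite -/q /m /copy_size -/s -mulnn; nia.
have ratio : 'C(m, s) * (r.-1 * (s - 2)) ^ s <= 'C(m - q, s) * (r * s.-1) ^ s.
  rewrite -(@leq_pmul2r s`!) ?fact_gt0 // mulnAC bin_ffact [X in _ <= X]mulnAC bin_ffact.
  rewrite !ffact_prod -[X in _ * _ ^ X <= _]card_ord -[X in _ <= _ * _ ^ X]card_ord.
  rewrite -!prod_nat_const -!big_split /=; apply: leq_prod => i _.
  have := leq_trunc_div m r; rewrite -/q /m /copy_size -/s -mulnn => rq.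
  apply: falling_factor_le => //; first exact: ltnW.
  by move: sm; rewrite /m /copy_size -mulnn -/s; lia.
have B0 : 0 < 'C(m - q, s) by rewrite bin_gt0.
rewrite -(leq_pmul2l B0) mulnA.
have le_bB : 'C(m - q, s) * copies_per_color n r <= k.+1 * 'C(m, s).
  rewrite /copies_per_color -/s -/k -/m -/q mulnS mulSn.
  rewrite leq_add ?leq_bin2l ?leq_subr // mulnC; exact: leq_trunc_div.
apply: leq_trans (leq_mul le_bB (leqnn _)) _.
by rewrite -mulnA [X in _ <= X]mulnCA leq_mul2l ratio orbT.
Qed.

Local Open Scope classical_set_scope.
Local Open Scope ring_scope.

(** The exponent 9 collects the subexponential factors, each at most a power of
    S ^ s: 3 for r * (k + 1), 1 for the surplus x ^ s coming from
    k * s <= n + s, 1 for ((s - 1) / (s - 2)) ^ (s * s), and 2 each for the choice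
    of positions and for the choice of an edge inside its box. *)
Lemma card_box_edges_le_ratio (R : realType) n r :
  let S : R := (box_width n)%:R in
  (1 < r)%N -> (r <= box_width n)%N -> (4 <= box_width n)%N -> expR 2 <= S ->
  #|edges (box_hypergraph n r)|%:R
    <= (r%:R / (r%:R - 1)) ^+ n * (S ^+ 9) ^+ box_width n.
Proof.
move=> S r1 rs s4 e2S; set s := box_width n in S rs s4 e2S *.
set k := box_height n; set b := copies_per_color n r.
have ks : (k <= s)%N := box_height_le_width n.
pose rho : R := r%:R; rewrite -/rho.
have rho2 : 2 <= rho by rewrite /rho ler_nat.
have S4 : 4 <= S by rewrite /S ler_nat.
have rhoS : rho <= S by rewrite /S ler_nat.
set x := rho / (rho - 1); pose y := (S - 1) / (S - 2).
have x1 : 1 <= x by rewrite /x ler_pdivlMr; lra.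
have x2 : x <= S by rewrite /x ler_pdivrMr; nra.
have y1 : 1 <= y by rewrite /y ler_pdivlMr; lra.
(* y ^ s <= exp (s / (s - 2)) <= exp 2 because s >= 4. *)
have yS : y ^+ s <= S.
  apply: le_trans e2S.
  have yexp : y <= expR (S - 2)^-1.
    apply: le_trans (expR_ge1Dx _); rewrite /y.
    by rewrite le_eqVlt; apply/orP; left; apply/eqP; field; lra.
  apply: le_trans (lerXn2r s _ _ yexp) _; rewrite ?nnegrE ?expR_ge0 //; first by lra.
  by rewrite -expRM_natr ler_expR -/S mulrC ler_pdivrMr; lra.
have [S0 x0 y0] : [/\ 0 <= S, 0 <= x & 0 <= y] by split; lra.
have S1 : 1 <= S by lra.
have b_le : (r * b)%:R <= S ^+ 3 * (x * y) ^+ s.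
  have := copies_per_color_le r1 (ltnW s4); rewrite -/s -/k -/b -(ler_nat R).
  rewrite -!subn1 !natrM !natrX !natrM !natrB ?(leq_trans _ s4) ?(ltnW r1) //.
  rewrite -/S -/rho => b_le; pose d := (rho - 1) * (S - 2).
  have d0 : 0 < d by rewrite /d; apply: mulr_gt0; lra.
  have -> : x * y = rho * (S - 1) / d.
    by rewrite /x /y /d mulf_div.
  rewrite expr_div_n mulrA ler_pdivlMr ?exprn_gt0 // -mulrA.
  apply: le_trans (ler_wpM2l _ b_le) _; first by lra.
  rewrite mulrA ler_wpM2r ?exprn_ge0 ?mulr_ge0 //; try lra.
  have kS : k.+1%:R <= S + 1 by rewrite -natr1 lerD2r ler_nat.
  rewrite [S ^+ 3]exprS; apply: ler_pM => //.
  by apply: le_trans kS _; rewrite expr2; nra.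
clearbody x y; have rb_le : ((r * b) ^ k)%:R <= x ^+ n * (S ^+ 5) ^+ s.
  rewrite natrX; apply: le_trans (lerXn2r k _ _ b_le) _; rewrite ?nnegrE ?ler0n //.
    by apply: mulr_ge0; apply: exprn_ge0 => //; apply: mulr_ge0.
  rewrite (exprMn k (S ^+ 3)) (exprMn s x) (exprMn k (x ^+ s)) -!exprM.
  have -> : x ^+ n * S ^+ (5 * s) = S ^+ (3 * s) * (x ^+ n * S ^+ s * S ^+ s).
    by rewrite mulrCA -!exprD -!mulrA -!exprD; congr (_ * _ ^+ _); lia.
  apply: ler_pM; rewrite ?mulr_ge0 ?exprn_ge0 //.
    by apply: ler_weXn2l => //; rewrite leq_mul2l.
  apply: ler_pM; rewrite ?exprn_ge0 //.
    apply: (@le_trans _ _ (x ^+ (n + s))).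
      by apply: ler_weXn2l => //; rewrite mulnC box_volume_le.
    by rewrite exprD ler_wpM2l ?exprn_ge0 ?lerXn2r ?nnegrE.
  rewrite exprM; apply: (@le_trans _ _ ((y ^+ s) ^+ s)).
    by apply: ler_weXn2l => //; rewrite exprn_ege1.
  by rewrite lerXn2r ?nnegrE ?exprn_ge0.
have sq_le : ('C(copy_size n, s) * 'C(k * s, n) <= (s ^ 4) ^ s)%N.
  have -> : (s ^ 4 = copy_size n * s ^ 2)%N by rewrite -expnD.
  rewrite expnMn leq_mul ?leq_bin_exp //.
  (* Choosing an edge in a box amounts to choosing the at most s omitted vertices. *)
  have nks := ltnW (box_volume_gt n); rewrite -(bin_sub nks).
  apply: leq_trans (leq_bin_exp _ _) _.
  apply: (@leq_trans ((s ^ 2) ^ (k * s - n))).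
    by case: (_ - n)%N => // e; rewrite leq_exp2r // -mulnn leq_mul2r ks orbT.
  by apply: leq_pexp2l; rewrite ?expn_gt0 // leq_subLR box_volume_le.
apply: (@le_trans _ _ (((r * b) ^ k) * (s ^ 4) ^ s)%:R).
  rewrite ler_nat (leq_trans (card_box_edges n r)) // leq_mul ?leq_bin_exp //.
rewrite natrM [X in _ * X]natrX [X in _ * X ^+ s]natrX -/S; apply: le_trans (ler_wpM2r _ rb_le) _.
  by rewrite !exprn_ge0.
by rewrite -mulrA -exprMn -exprD.
Qed.

(** * Passing to n-th roots *)

Lemma card_edges_ge_ratio (R : realType) n r (H : hypergraph) : (1 < r)%N ->
  uniform n H -> ~ (exists f : vertex H -> 'I_r, panchromatic f) ->
  (r%:R / (r%:R - 1)) ^+ n <= r%:R * #|edges H|%:R :> R.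
Proof.
move=> r1 unif nopan; have := card_edges_ge (ltnW r1) unif nopan.
have r1R : 0 < r%:R - 1 :> R by rewrite subr_gt0 ltr1n.
rewrite -(ler_nat R) !natrM !natrX -subn1 natrB ?(ltnW r1) // => le_E.
rewrite expr_div_n ler_pdivrMr ?exprn_gt0 //; apply: le_trans le_E _.
by rewrite mulrCA mulrA.
Qed.

(** For n = 0 the n-th power carries no information, so the number of edges must
    be exactly 1: the empty set is then the only possible edge. *)
Lemma card_edges_uniform0 r (H : hypergraph) : (0 < r)%N -> uniform 0 H ->
  ~ (exists f : vertex H -> 'I_r, panchromatic f) -> #|edges H| = 1%N.
Proof.
move=> r0 unif nopan; apply/eqP; rewrite eqn_leq; apply/andP; split; last first.
  by have := card_edges_ge r0 unif nopan; rewrite !expn0; case: #|_|.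
rewrite -(cards1 (@finset.set0 (vertex H))); apply: subset_leq_card.
by apply/fintype.subsetP => e /unif /cards0_eq ->; rewrite inE.
Qed.

(** A rate d with s ^ (9 * s) <= exp (n * d).  From
    s = sqrt s ^ 2 <= exp (2 * sqrt s) the left side is at most
    exp (18 * s ^ 2 / sqrt s), and s ^ 2 <= 4 * n gives the factor 72. *)
Definition box_rate {R : realType} (n : nat) : R :=
  72 * Num.sqrt ((box_width n)%:R)^-1.

Lemma box_width_cvgy : box_width n @[n --> \oo] --> \oo.
Proof.
apply/cvgnyPge => A; near=> n.
have : (A ^ 2 <= n)%N by near: n; exact: nbhs_infty_ge.
move=> /leq_ltn_trans /(_ (lt_box_width_sq n)).
by rewrite ltn_exp2r // => /ltnW.
Unshelve. all: by end_near. Qed.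

Lemma box_rate_cvg0 (R : realType) : box_rate n @[n --> \oo] --> (0 : R).
Proof.
have inv0 : ((box_width n)%:R^-1 : R) @[n --> \oo] --> (0 : R).
  apply: (cvg_comp (fun n => Nat.sqrt n) (@harmonic R)); last exact: cvg_harmonic.
  apply/cvgnyPge => A; have /cvgnyPge/(_ A.+1) := box_width_cvgy.
  by apply: filterS => n.
have sq0 : Num.sqrt (box_width n)%:R^-1 @[n --> \oo] --> Num.sqrt (0 : R).
  exact: (continuous_cvg _ (@sqrt_continuous R 0) inv0).
rewrite sqrtr0 in sq0; rewrite -[0 in X in _ --> X](mulr0 (72 : R)).
by apply: cvgM => //; exact: cvg_cst.
Qed.

Lemma box_width_pow_le (R : realType) n : (0 < n)%N ->
  ((box_width n)%:R ^+ 9) ^+ box_width n <= expR (box_rate n) ^+ n :> R.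
Proof.
move=> n0; rewrite -exprM /box_rate; set s := box_width n; set S : R := s%:R.
have s2 : (s ^ 2 <= 4 * n)%N.
  have := PeanoNat.Nat.sqrt_spec n (PeanoNat.Nat.le_0_l n).
  by rewrite -mulnn /s /box_width; nia.
have S0 : 0 < S by rewrite ltr0n.
have sqS : Num.sqrt S ^+ 2 = S by rewrite sqr_sqrtr ?(ltW S0).
have S_le : S <= expR (2 * Num.sqrt S).
  rewrite expRM_natl -{1}sqS lerXn2r ?nnegrE ?sqrtr_ge0 ?expR_ge0 //.
  by apply: le_trans (expR_ge1Dx _); rewrite lerDr.
apply: le_trans (lerXn2r _ _ _ S_le) _; rewrite ?nnegrE ?expR_ge0 ?(ltW S0) //.
rewrite -!expRM_natr ler_expR sqrtrV ?(ltW S0) // natrM -/S.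
have q0 : 0 < Num.sqrt S by rewrite sqrtr_gt0.
rewrite [X in _ <= X]mulrAC ler_pdivlMr //.
have -> : 2 * Num.sqrt S * (9 * S) * Num.sqrt S = 18 * S * Num.sqrt S ^+ 2 by ring.
rewrite sqS; have : S ^+ 2 <= 4 * n%:R by rewrite -natrX -natrM ler_nat.
by rewrite expr2; lra.
Qed.

(** The n-th root of N n lies between x n * exp (- d n) and x n * exp (d n); the
    bound on x makes the relative error an absolute one. *)
Lemma nth_root_sub_cvg0 (R : realType) (N x d : nat -> R) :
  (forall n, 0 <= N n) -> (forall n, 0 <= x n <= 2) ->
  d n @[n --> \oo] --> (0 : R) ->
  (\forall n \near \oo, (x n * expR (- d n)) ^+ n <= N n <= (x n * expR (d n)) ^+ n) ->
  (N n `^ n%:R^-1 - x n) @[n --> \oo] --> (0 : R).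
Proof.
move=> N0 x02 d0 bounds.
have cvgE (e : nat -> R) : e n @[n --> \oo] --> (0 : R) ->
    (2 * `|expR (e n) - 1|) @[n --> \oo] --> (0 : R).
  move=> e0; have E1 : expR (e n) @[n --> \oo] --> (1 : R).
    by rewrite -expR0; exact: (continuous_cvg _ (@continuous_expR R 0) e0).
  rewrite -[0 in X in _ --> X](mulr0 (2 : R)); apply: cvgM; first exact: cvg_cst.
  rewrite -[0 in X in _ --> X](normr0 R) -(subrr (1 : R)).
  by apply: cvg_norm; apply: cvgB => //; exact: cvg_cst.
have dN0 : - d n @[n --> \oo] --> (0 : R) by rewrite -oppr0; exact: cvgN.
apply: (@squeeze_cvgr _ _ _ _ (fun n => - (2 * `|expR (- d n) - 1|))
  (fun n => 2 * `|expR (d n) - 1|)); last exact: cvgE.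
  near=> n.
  have n0 : (0 < n)%N by near: n; exact: nbhs_infty_gt.
  have /andP[lo hi] : (x n * expR (- d n)) ^+ n <= N n <= (x n * expR (d n)) ^+ n.
    by near: n.
  have /andP[x0 x2] := x02 n.
  set y := N n `^ _; have y0 : 0 <= y by exact: powR_ge0.
  have yn : y ^+ n = N n.
    rewrite -powR_mulrn // -powRrM mulVf ?powRr1 //.
    by rewrite pnatr_eq0 -lt0n.
  have xE e : 0 <= x n * expR e by rewrite mulr_ge0 ?expR_ge0.
  have xe e : `|x n * expR e - x n| <= 2 * `|expR e - 1|.
    rewrite -{2}[x n]mulr1 -mulrBr normrM ler_wpM2r //.
    by rewrite ger0_norm.
  rewrite -yn ler_pXn2r ?nnegrE // in lo; rewrite -yn ler_pXn2r ?nnegrE // in hi.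
  have := xe (d n); have := xe (- d n); rewrite !ler_norml => /andP[h1 h2] /andP[h3 h4].
  by apply/andP; split; lra.
by rewrite -oppr0; apply: cvgN; exact: cvgE.
Unshelve. all: by end_near. Qed.

Theorem theorem1p9 (R : realType) (r : nat -> nat)
    (r_ge2 : forall n, (2 <= r n)%N)
    (r_small : (fun n => (r n)%:R : R) =o_\oo
               (fun n => Num.sqrt (n%:R / ln n%:R) : R)) :
  let H := fun n => box_hypergraph n (r n) in
  [/\ forall n, uniform n (H n),
      forall n, ~ exists f : vertex (H n) -> 'I_(r n), panchromatic f
    & exists2 eps : nat -> R, eps n @[n --> \oo] --> (0 : R) &
        forall n, #|edges (H n)|%:R = ((r n)%:R / ((r n)%:R - 1) + eps n) ^+ n].
Proof.
move=> H; have unif n : uniform n (H n) by exact: box_uniform.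
have nopan n : ~ exists f : vertex (H n) -> 'I_(r n), panchromatic f.
  exact: box_not_panchromatic.
split=> //; pose x n : R := (r n)%:R / ((r n)%:R - 1).
have x02 n : 0 <= x n <= 2.
  have r2 : 2 <= (r n)%:R :> R by rewrite ler_nat.
  by rewrite /x divr_ge0 ?ler_pdivrMr; lra.
exists (fun n => (#|edges (H n)|%:R `^ n%:R^-1) - x n); last first.
  move=> [|n]; last first.
    rewrite [X in X ^+ _]addrC subrK -powR_mulrn ?powR_ge0 // -powRrM mulVf ?powRr1 //.
  by rewrite expr0 (card_edges_uniform0 (ltnW (r_ge2 0)) (@unif 0) (@nopan 0)).
apply: nth_root_sub_cvg0 (@box_rate_cvg0 R) _ => //.
near=> n.
have n0 : (0 < n)%N by near: n; exact: nbhs_infty_gt.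
have r_le : (r n <= box_width n)%N.
  have rn : (r n)%:R <= Num.sqrt (n%:R / ln n%:R) :> R.
    near: n; have /eqoP/(_ 1 ltr01) := r_small; apply: filterS => n.
    by rewrite normr_nat mul1r ger0_norm ?sqrtr_ge0.
  rewrite -(@leq_exp2r _ _ 2) // ltnW //; apply: leq_ltn_trans (lt_box_width_sq n).
  rewrite -(ler_nat R) natrX -(sqr_sqrtr (ler0n R n)).
  rewrite lerXn2r ?nnegrE ?sqrtr_ge0 //; apply: le_trans rn _.
  have ln1 : 1 <= ln n%:R :> R.
    rewrite -[X in X <= _]expRK ler_ln ?posrE ?expR_gt0 ?ltr0n //.
    by near: n; exact: nbhs_infty_ger.
  rewrite ler_wsqrtr // ler_pdivrMr ?ler_peMr //.
  exact: lt_le_trans ln1.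
have e2S : expR 2 <= (box_width n)%:R :> R.
  by near: n; exact: (box_width_cvgy (nbhs_infty_ger (expR (2 : R)))).
have s4 : (4 <= box_width n)%N.
  by near: n; have /cvgnyPge/(_ 4) := box_width_cvgy.
apply/andP; split; last first.
  rewrite exprMn; apply: le_trans (card_box_edges_le_ratio _ r_le s4 e2S) _ => //.
  by rewrite ler_wpM2l ?box_width_pow_le ?exprn_ge0 //; have /andP[] := x02 n.
rewrite expRN exprMn exprVn ler_pdivrMr ?exprn_gt0 ?expR_gt0 //.
apply: le_trans (card_edges_ge_ratio R (r_ge2 n) (@unif n) (@nopan n)) _.
(* The loss of a factor r in the lower bound is at most s <= s ^ (9 * s). *)
rewrite mulrC ler_wpM2l //; apply: le_trans (box_width_pow_le R n0).
rewrite -exprM; apply: (@le_trans _ _ ((box_width n)%:R ^+ 1)).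
  by rewrite expr1 ler_nat.
by apply: ler_weXn2l; rewrite ?ler1n ?muln_gt0.
Unshelve. all: by end_near. Qed.
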